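(* Let $I\subset\mathcal{O}_{X(S)}$ be a monomial ideal. If $h\in\overline{I}$ then $supp(h)\subset\Gamma_+(I)$.
   Context: $S\subset\mathbb{Z}^n_+$ is a semigroup generated by a finite set $\{b_1,\dots,b_r\}\subset\mathbb{Z}^n_+$ with $\mathbb{Z}b_1+\cdots+\mathbb{Z}b_r=\mathbb{Z}^n$. The affine toric variety is $X(S)=V(I_S)\subset\mathbb{C}^r$, where $I_S=\langle x^{\alpha_+}-x^{\alpha_-}:\alpha\in\mathbb{Z}^r,\ \sum_i\alpha_ib_i=0\rangle\subset\mathbb{C}[x_1,\dots,x_r]$, $\alpha_+=\sum_{\alpha_i>0}\alpha_ie_i$, $\alpha_-=-\sum_{\alpha_i<0}\alpha_ie_i$ (not necessarily normal). $\mathcal{O}_{X(S)}$ is the ring of germs at $0$ of analytic functions on $X(S)$: each $g\in\mathcal{O}_{X(S)}$ is $g=f|_{X(S)}$ with $f:\mathbb{C}^r\to\mathbb{C}$ analytic, with Taylor expansion $f=\sum_ka_kx^k$, where $x^k=x_1^{k_1}\cdots x_r^{k_r}$. A monomial ideal is an ideal generated by monomials $x^k$. $cone(S)=\{\sum_i\lambda_ib_i:\lambda_i\in\mathbb{R},\ \lambda_i\ge0\}\subset\mathbb{R}^n$ is assumed of dimension $n$ and strongly convex ($cone(S)\cap(-cone(S))=\{0\}$). For $A\subset S$, $\Gamma_+(A)$ is the convex hull of $\{k+v:k\in A,\ v\in cone(S)\}$. For $g=f|_{X(S)}$ with $f=\sum_ka_kx^k$, $supp(g)=\{k_1b_1+\cdots+k_rb_r\in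 S: a_k\ne0,\ k=(k_1,\dots,k_r)\}$. For $G\subseteq\mathcal{O}_{X(S)}$, $supp(G)$ is the union of the supports of the elements of $G$ and $\Gamma_+(G)=\Gamma_+(supp(G))$; if $I$ is the ideal generated by $G$, $\Gamma_+(I)=\Gamma_+(G)$. $\overline{I}$ is the integral closure of $I$: the ideal of all $h\in\mathcal{O}_{X(S)}$ satisfying a relation $h^m+a_1h^{m-1}+\cdots+a_m=0$ with $a_i\in I^i$.
   Formalization: The support of a germ g, which as written depends on the analytic f chosen with g = f restricted to X(S), is taken to be the set of degrees common to the supports of all analytic f representing g; with an arbitrary f the claim fails. *)

(* Defs.v *)
From HB Require Import structures.
From mathcomp Require Import all_boot all_order all_algebra finmap.
From mathcomp Require Import complex.
From mathcomp Require Import (canonicals, hints) mpoly.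
From mathcomp Require Import all_classical all_reals all_analysis.
From mathcomp.analysis.showcase Require summability.

Set Implicit Arguments.
Unset Strict Implicit.
Unset Printing Implicit Defensive.

Import Order.TTheory GRing.Theory Num.Theory.
Import numFieldNormedType.Exports.

Local Open Scope classical_set_scope.
Local Open Scope ring_scope.

(* The usual topology of the complex numbers, given by the modulus. *)
HB.instance Definition _ (R : realType) := NormedModule.copy R[i] R[i]^o.

Section Lattice.
Variables (n r : nat) (b : 'I_r -> 'rV[int]_n).

(* The semigroup S is the range of [degS]; on X(S) the monomial x^k is the
   character of degree [degS k]. *)
Definition degS (k : {ffun 'I_r -> nat}) : 'rV[int]_n := \sum_(i < r) b i *+ k i.

Definition generates_lattice : Prop :=
  forall v : 'rV[int]_n, exists c : 'I_r -> int, v = \sum_(i < r) c i *: b i.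

Definition nonneg_generators : Prop :=
  forall (i : 'I_r) (j : 'I_n), 0 <= b i ord0 j.

End Lattice.

Section Cone.
Variables (R : realType) (n r : nat) (b : 'I_r -> 'rV[int]_n).

Definition toR (v : 'rV[int]_n) : 'rV[R]_n := map_mx intr v.

Definition cone : set 'rV[R]_n :=
  [set v | exists2 c : 'I_r -> R,
     forall i, 0 <= c i & v = \sum_(i < r) c i *: toR (b i)].

(* The dimension of a cone is the dimension of its linear span. *)
Definition full_dimensional (A : set 'rV[R]_n) : Prop :=
  forall V : {vspace 'rV[R]_n}, A `<=` [set` V] -> \dim V = n.

Definition strongly_convex (A : set 'rV[R]_n) : Prop :=
  A `&` [set - v | v in A] = [set 0].

Definition convex_hull (A : set 'rV[R]_n) : set 'rV[R]_n :=
  smallest (@convex_set R 'rV[R]_n) A.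

Definition Gamma_plus (A : set 'rV[int]_n) : set 'rV[R]_n :=
  convex_hull [set w | exists k v, [/\ A k, cone v & w = toR k + v]].

End Cone.

Arguments toR R {n} v.
Arguments cone R {n r} b.
Arguments Gamma_plus R {n r} b A.

Section ToricVariety.
Variables (R : realType) (n r : nat) (b : 'I_r -> 'rV[int]_n).
Local Notation C := R[i].
Local Notation poly := (mpoly.mpoly r C).

Definition ring_ideal_gen (A : comPzRingType) (G : set A) : set A :=
  [set p | exists (m : nat) (c g : 'I_m -> A),
     (forall j, G (g j)) /\ p = \sum_(j < m) c j * g j].

Definition poly_monomial (e : 'I_r -> nat) : poly :=
  \prod_(i < r) mpoly.mpolyX C (mpoly.mnm1 i) ^+ e i.

Definition pos_part (alpha : 'I_r -> int) (i : 'I_r) : nat :=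
  `|Num.max (alpha i) 0|%N.
Definition neg_part (alpha : 'I_r -> int) (i : 'I_r) : nat :=
  `|Num.max (- alpha i) 0|%N.

Definition toric_ideal : set poly :=
  ring_ideal_gen [set p | exists2 alpha : 'I_r -> int,
    \sum_(i < r) alpha i *: b i = 0 &
    p = poly_monomial (pos_part alpha) - poly_monomial (neg_part alpha)].

Definition toric_variety : set 'rV[C]_r :=
  [set x | forall p, toric_ideal p -> mpoly.meval (fun i => x ord0 i) p = 0].

End ToricVariety.

Section Germs.
Variables (R : realType) (n r : nat) (b : 'I_r -> 'rV[int]_n).
Local Notation C := R[i].
Local Notation fn := ('rV[C]_r -> C).
Local Notation X := (@toric_variety R n r b).

Definition monomial (k : {ffun 'I_r -> nat}) : fn :=
  fun x => \prod_(i < r) x ord0 i ^+ k i.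

(* Convergence along the net of finite sets of exponents, that is,
   unconditional convergence of the multiple series. *)
Definition taylor_at0 (f : fn) (a : {ffun 'I_r -> nat} -> C) : Prop :=
  \forall x \near (0 : 'rV[C]_r),
    summability.partial_sum (fun k => a k * monomial k x) @ summability.totally
      --> f x.

Definition analytic_at0 (f : fn) : Prop := exists a, taylor_at0 f a.

(* A germ at 0 on X(S) is represented by any function on the ambient space
   with the right values on X(S) near 0; [germ_eq] is equality of germs, and
   every notion below is invariant under it. *)
Definition germ_eq (f g : fn) : Prop :=
  \forall x \near (0 : 'rV[C]_r), X x -> f x = g x.

Definition OX : set fn :=
  [set g | exists2 f, analytic_at0 f & germ_eq g f].

Definition ideal_gen (G : set fn) : set fn :=
  [set h | OX h /\ exists (m : nat) (c g : 'I_m -> fn),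
     [/\ forall j, OX (c j), forall j, G (g j) &
         germ_eq h (fun x => \sum_(j < m) c j x * g j x)]].

Definition monomial_ideal (I : set fn) : Prop :=
  exists K : set {ffun 'I_r -> nat}, I = ideal_gen (monomial @` K).

Definition ideal_pow (I : set fn) (i : nat) : set fn :=
  ideal_gen [set p | exists2 u : 'I_i -> fn, (forall j, I (u j)) &
    p = fun x => \prod_(j < i) u j x].

Definition integral_closure (I : set fn) : set fn :=
  [set h | OX h /\ exists (m : nat) (a : nat -> fn),
     [/\ (0 < m)%N,
         forall i, (1 <= i <= m)%N -> ideal_pow I i (a i) &
         germ_eq (fun x => h x ^+ m + \sum_(1 <= i < m.+1) a i x * h x ^+ (m - i))
                 (fun=> 0)]].

Definition supp_rep (f : fn) : set 'rV[int]_n :=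
  [set s | exists a k, [/\ taylor_at0 f a, a k != 0 & s = degS b k]].

(* The set {degS k | a_k != 0} depends on the power series f chosen to
   represent g: when x^k and x^l agree on X(S), the zero germ is represented
   by x^k - x^l.  The support of the germ g is the part common to all its
   analytic representatives; when no b_i is zero, s belongs to it iff the
   sum of the a_k over degS k = s is nonzero. *)
Definition supp (g : fn) : set 'rV[int]_n :=
  \bigcap_(f in [set f | analytic_at0 f /\ germ_eq g f]) supp_rep f.

Definition supp_set (G : set fn) : set 'rV[int]_n := \bigcup_(g in G) supp g.

End Germs.

(* Main.v *)
Require Import Defs.
From mathcomp Require Import all_boot all_order all_algebra finmap.
From mathcomp Require Import complex.
From mathcomp Require Import (canonicals, hints) mpoly.
From mathcomp Require Import all_classical all_reals all_analysis.
From mathcomp Require Import zify ring lra.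
From mathcomp.analysis.showcase Require summability.

(* If toR s lies outside Gamma_+(G), a theorem of the alternative over the
   integers gives an integral functional l, positive on the b_i, with
   l s < l s' for every s' in supp G; a generic perturbation makes s the only
   element of S on the level l = l s.  Along the curve t |-> (t^(l b_i))_i of
   X(S), t -> 0+, the elements of I are O(t^(l s + 1)), and so are those
   integral over I.  But the coefficient of t^(l s) in the expansion of h along
   the curve is the sum of the a_k with degS k = s, which is nonzero. *)

Set Implicit Arguments.
Unset Strict Implicit.
Unset Printing Implicit Defensive.

Import Order.TTheory GRing.Theory Num.Theory.
Import numFieldNormedType.Exports.

Local Open Scope classical_set_scope.
Local Open Scope ring_scope.
Local Notation "x %:C" := (real_complex _ x) : ring_scope.

(** * Integral functionals *)

(** The alternative is integral because the exponents of the curve must be natural numbers. A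
    functional positive on the b_i and on the differences s' - s fails to exist only if a nontrivial
    nonnegative integral combination of these vectors vanishes. As the b_i are nonzero with
    nonnegative coordinates, such a relation involves a difference, and solving it for s puts s in
    the polyhedron. The alternative concerns finite lists, while supp G may be infinite: Dickson's
    lemma reduces to finitely many members, every other one being one of these plus an element of S.
    Isolating s on its level matters because the coefficient of t^(l s) collects all a_k with l
    (degS k) = l s, and other fibers of degS could cancel the one over s. A single fiber cannot be
    split further, since its monomials coincide on X(S); its sum is therefore an invariant of the
    germ. *)

Lemma dickson_on r (J : seq 'I_r) (T : set {ffun 'I_r -> nat}) :
  exists F : seq {ffun 'I_r -> nat}, (forall f, f \in F -> T f) /\
    forall k, T k -> exists2 f, f \in F & forall i, i \in J -> (f i <= k i)%N.
Proof.
elim: J T => [|j J IH] T.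
  have [[k Tk]|T0] := pselect (exists k, T k).
    exists [:: k]; split=> [f|k' _]; first by rewrite inE => /eqP ->.
    by exists k; rewrite ?mem_head.
  by exists [::]; split=> // k Tk; case: T0; exists k.
have [F0 [F0T F0P]] := IH T.
have [F FP] := choice (fun m => IH [set k | T k /\ k j = m]).
(* Elements with coordinate [j] at least [M] dominate a member of [F0] in that coordinate too; the
   others lie in the finitely many slices [k j = m] with [m < M]. *)
pose M := \max_(f <- F0) f j.
exists (F0 ++ flatten [seq F m | m <- iota 0 M]); split=> [f|k Tk].
  rewrite mem_cat => /orP[/F0T //|/flatten_mapP[m _ fm]].
  by have [/(_ _ fm)[]] := FP m.
have [Mk|kM] := leqP M (k j).
  have [f fF0 fk] := F0P k Tk; exists f; first by rewrite mem_cat fF0.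
  move=> i; rewrite inE => /predU1P[->|/fk //].
  by apply: leq_trans Mk; exact: leq_bigmax_seq.
have [FT FP'] := FP (k j).
have [f fF fk] := FP' k (conj Tk erefl).
exists f.
  rewrite mem_cat; apply/orP; right; apply/flatten_mapP.
  by exists (k j) => //; rewrite mem_iota.
by move=> i; rewrite inE => /predU1P[->|/fk //]; have [_ ->] := FT _ fF.
Qed.

Definition dot n (l : 'cV[int]_n) (v : 'rV[int]_n) : int := (v *m l) ord0 ord0.

Section Dot.
Variable n : nat.
Implicit Types (l : 'cV[int]_n) (v : 'rV[int]_n).

Lemma dotDr l v1 v2 : dot l (v1 + v2) = dot l v1 + dot l v2.
Proof. by rewrite /dot mulmxDl mxE. Qed.

Lemma dotNr l v : dot l (- v) = - dot l v.
Proof. by rewrite /dot mulNmx mxE. Qed.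

Lemma dotBr l v1 v2 : dot l (v1 - v2) = dot l v1 - dot l v2.
Proof. by rewrite dotDr dotNr. Qed.

Lemma dotZr l c v : dot l (c *: v) = c * dot l v.
Proof. by rewrite /dot -scalemxAl mxE. Qed.

Lemma dotDl l1 l2 v : dot (l1 + l2) v = dot l1 v + dot l2 v.
Proof. by rewrite /dot mulmxDr mxE. Qed.

Lemma dotZl c l v : dot (c *: l) v = c * dot l v.
Proof. by rewrite /dot -scalemxAr mxE. Qed.

Lemma dot0r l : dot l 0 = 0.
Proof. by rewrite /dot mul0mx mxE. Qed.

Lemma dot_sumr l (I : finType) (F : I -> 'rV[int]_n) :
  dot l (\sum_i F i) = \sum_i dot l (F i).
Proof. by rewrite /dot mulmx_suml summxE. Qed.

Lemma dot_tr_gt0 v : v != 0 -> 0 < dot v^T v.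
Proof.
move=> v0; rewrite /dot mxE lt_def sumr_ge0 ?andbT; last first.
  by move=> i _; rewrite mxE -expr2 sqr_ge0.
apply: contra v0; rewrite psumr_eq0; last first.
  by move=> i _; rewrite mxE -expr2 sqr_ge0.
move=> /allP H; apply/eqP/rowP => i; rewrite mxE; apply/eqP.
by have := H i (mem_index_enum _); rewrite mxE mulf_eq0 orbb.
Qed.

Lemma dot_bound l (V : seq 'rV[int]_n) :
  exists2 M : int, 0 < M & forall v, v \in V -> `|dot l v| < M.
Proof.
elim: V => [|u V [M M0 MV]]; first by exists 1.
exists (M + `|dot l u|) => [|v]; first by rewrite ltr_pwDl.
rewrite inE => /predU1P[->|/MV vM]; first by rewrite ltrDr.
by rewrite ltr_wpDr.
Qed.

End Dot.

(** The sums have at least one term, so [posspan V 0] is a nontrivial nonnegative relation among the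
    members of [V]. *)
Inductive posspan n (V : seq 'rV[int]_n) : 'rV[int]_n -> Prop :=
| posspan_mem v of v \in V : posspan V v
| posspanD u v of posspan V u & posspan V v : posspan V (u + v).

Lemma posspanZ n (V : seq 'rV[int]_n) (c : int) v :
  0 < c -> posspan V v -> posspan V (c *: v).
Proof.
case: c => // -[//|m] _ Vv; elim: m => [|m IH]; first by rewrite scale1r.
by rewrite intS scalerDl scale1r; exact: posspanD.
Qed.

Lemma posspan_trans n (V W : seq 'rV[int]_n) v :
  (forall u, u \in W -> posspan V u) -> posspan W v -> posspan V v.
Proof. by move=> WV; elim=> [u /WV //|u w _ Vu _ Vw]; exact: posspanD. Qed.

(* Induction on the list: if l is positive on V but not on v, apply the
   induction hypothesis to the combinations of v and the u in V killed by l;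
   this yields a functional vanishing at v and positive on V, to which a small
   multiple of v^T is added. *)
Lemma gordan n (V : seq 'rV[int]_n) :
  ~ posspan V 0 -> exists l, forall v, v \in V -> 0 < dot l v.
Proof.
move: {2}(size V) (erefl (size V)) => N; elim: N V => [|N IH] [|v V] //=.
  by exists 0.
move=> [sV] V0; have [|l lV] := IH V sV.
  move=> H; apply: V0; apply: posspan_trans H => u uV.
  by apply: posspan_mem; rewrite inE uV orbT.
have [lv|lv] := ltP 0 (dot l v).
  by exists l => u; rewrite inE => /predU1P[->|/lV].
pose w u := dot l u *: v + (- dot l v) *: u.
have Vv : posspan (v :: V) v by apply: posspan_mem; rewrite mem_head.
have Vw u : u \in V -> posspan (v :: V) (w u).
  move=> uV; have vl := posspanZ (lV _ uV) Vv.
  rewrite /w; move: lv; rewrite le_eqVlt => /predU1P[->|lv].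
    by rewrite oppr0 scale0r addr0.
  apply: posspanD => //; apply: posspanZ; first by rewrite oppr_gt0.
  by apply: posspan_mem; rewrite inE uV orbT.
have [||l2 l2w] := IH (map w V); first by rewrite size_map.
  move=> H; apply: V0; apply: posspan_trans H => _ /mapP[u uV ->].
  exact: Vw.
(* This is the pullback of [l2] under [w]: [dot l3 u = dot l2 (w u)] for every [u], while
   [w v = 0]. *)
pose l3 := (- dot l v) *: l2 + dot l2 v *: l.
have l3v : dot l3 v = 0 by rewrite dotDl !dotZl; ring.
have l3V u : u \in V -> 0 < dot l3 u.
  move=> uV; have := l2w _ (map_f w uV).
  by rewrite /w dotDr !dotZr dotDl !dotZl addrC [X in _ < _ + X]mulrC.
have v0 : v != 0 by apply: contra_notN V0 => /eqP <-.
have [M M0 MV] := dot_bound v^T V.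
exists (M *: l3 + v^T) => u; rewrite dotDl dotZl inE => /predU1P[->|uV].
  by rewrite l3v mulr0 add0r dot_tr_gt0.
have := l3V _ uV; have := MV _ uV; rewrite ltr_norml => /andP[] *; nia.
Qed.

(** Finitely many hyperplanes do not cover the dual lattice. If [l] kills [v], then [v^T] does not;
    added to a large multiple of [l], it leaves the nonzero integer values on [V] nonzero. *)
Lemma generic_functional n (V : seq 'rV[int]_n) :
  (forall v, v \in V -> v != 0) -> exists l, forall v, v \in V -> dot l v != 0.
Proof.
elim: V => [|v V IH] V0; first by exists 0.
have [|l lV] := IH; first by move=> u uV; rewrite V0 // inE uV orbT.
have [lv|lv] := eqVneq (dot l v) 0; last first.
  by exists l => u; rewrite inE => /predU1P[->|/lV].
have [M M0 MV] := dot_bound v^T V.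
exists (M *: l + v^T) => u; rewrite dotDl dotZl inE => /predU1P[->|uV].
  by rewrite lv mulr0 add0r gt_eqF // dot_tr_gt0 // V0 // mem_head.
have := lV _ uV; have := MV _ uV; rewrite ltr_norml => /andP[] *; nia.
Qed.

Lemma degSE n r (b : 'I_r -> 'rV[int]_n) (l : 'cV[int]_n) k :
  dot l (degS b k) = \sum_i dot l (b i) * (k i)%:Z.
Proof.
rewrite dot_sumr; apply: eq_bigr => i _.
by rewrite -scaler_nat dotZr mulrC natz.
Qed.

Lemma separation n r (b : 'I_r -> 'rV[int]_n) (V : seq 'rV[int]_n) s0 :
  (forall i, b i \in V) -> ~ posspan V 0 ->
  exists2 l, forall v, v \in V -> 0 < dot l v &
    forall k, dot l (degS b k) = dot l s0 -> degS b k = s0.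
Proof.
move=> bV /gordan[l0 l0V]; pose l := 2%:Z *: l0.
have lV v : v \in V -> 1 < dot l v by rewrite dotZl => /l0V; lia.
pose N := `|dot l s0|%N.
pose ks : seq {ffun 'I_r -> nat} :=
  [seq [ffun i => nat_of_ord (k i)] | k : {ffun 'I_r -> 'I_N.+1}].
pose F := [seq u <- [seq degS b k - s0 | k <- ks] | u != 0].
have [u|q qF] := @generic_functional n F; first by rewrite mem_filter => /andP[].
have [M M0 MV] := dot_bound q (s0 :: V ++ F).
have {}MV v : v \in s0 :: V ++ F -> - M < dot q v < M.
  by move=> /MV; rewrite ltr_norml.
exists (M *: l + q) => [v vV|k].
  rewrite dotDl dotZl.
  have /andP[] : - M < dot q v < M by apply: MV; rewrite inE mem_cat vV orbT.
  by have := lV _ vV => *; nia.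
move=> E; have Mb i : M <= dot (M *: l + q) (b i).
  have := lV _ (bV i); rewrite dotDl dotZl.
  have /andP[] : - M < dot q (b i) < M by apply: MV; rewrite inE mem_cat bV orbT.
  by move=> *; nia.
have kN i : (k i <= N)%N.
  have : M * (k i)%:Z <= dot (M *: l + q) s0.
    rewrite -E degSE (bigD1 i) //= ler_wpDr // ?ler_wpM2r //.
    by apply: sumr_ge0 => j _; rewrite mulr_ge0 // (le_trans (ltW M0)).
  have /andP[] : - M < dot q s0 < M by apply: MV; rewrite mem_head.
  by rewrite dotDl dotZl /N => *; nia.
apply/eqP; rewrite -subr_eq0; apply/negPn/negP => u0.
have uF : degS b k - s0 \in F.
  rewrite mem_filter u0; apply/map_f/mapP.
  exists [ffun i => inord (k i)]; first by rewrite mem_enum.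
  by apply/ffunP => i; rewrite !ffunE inordK // ltnS.
have := qF _ uF.
have /andP[] : - M < dot q (degS b k - s0) < M.
  by apply: MV; rewrite inE mem_cat uF !orbT.
(* As the second term is smaller than [M] in absolute value, both terms vanish, against the
   genericity of [q] on [F]. *)
have : M * dot l (degS b k - s0) + dot q (degS b k - s0) = 0.
  by rewrite -dotZl -dotDl dotBr E subrr.
set x := dot q _; set p := dot l _ => E0 xlo xhi /eqP x0.
by case: (ltrgtP p 0) => p0; nia.
Qed.

Lemma gen_dot_gt0 n r (b : 'I_r -> 'rV[int]_n) i :
  nonneg_generators b -> b i != 0 -> 0 < dot (const_mx 1) (b i).
Proof.
move=> b0 bN0; rewrite /dot mxE lt_def; apply/andP; split; last first.
  by apply: sumr_ge0 => j _; rewrite mxE mulr1.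
apply: contra bN0; rewrite psumr_eq0 => [/allP H|j _]; last first.
  by rewrite mxE mulr1.
apply/eqP/rowP => j; rewrite mxE; apply/eqP.
by have := H j (mem_index_enum _); rewrite mxE mulr1.
Qed.

Lemma posspan_dot_gt0 n (V : seq 'rV[int]_n) l u :
  (forall v, v \in V -> 0 < dot l v) -> posspan V u -> 0 < dot l u.
Proof. by move=> lV; elim=> [v /lV //|v w _ ? _ ?]; rewrite dotDr addr_gt0. Qed.

(** * Convex hulls *)

Section Convexity.
Variables (R : realType) (n r : nat) (b : 'I_r -> 'rV[int]_n).

Lemma toRD (u v : 'rV[int]_n) : toR R (u + v) = toR R u + toR R v.
Proof. exact: map_mxD. Qed.

Lemma toRB (u v : 'rV[int]_n) : toR R (u - v) = toR R u - toR R v.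
Proof. exact: map_mxB. Qed.

Lemma cone0 : cone R b 0.
Proof. by exists (fun=> 0) => //; rewrite big1 // => i _; rewrite scale0r. Qed.

Lemma coneD u v : cone R b u -> cone R b v -> cone R b (u + v).
Proof.
move=> [c c0 ->] [d d0 ->]; exists (fun i => c i + d i).
  by move=> i; rewrite addr_ge0.
by rewrite -big_split; apply: eq_bigr => i _; rewrite /= scalerDl.
Qed.

Lemma coneZ (a : R) v : 0 <= a -> cone R b v -> cone R b (a *: v).
Proof.
move=> a0 [c c0 ->]; exists (fun i => a * c i) => [i|]; first by rewrite mulr_ge0.
by rewrite scaler_sumr; apply: eq_bigr => i _; rewrite scalerA.
Qed.

Lemma cone_gen i : cone R b (toR R (b i)).
Proof.
exists (fun j => (j == i)%:R) => [j|]; first by rewrite ler0n.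
rewrite (bigD1 i) //= eqxx scale1r big1 ?addr0 // => j /negbTE ->.
by rewrite scale0r.
Qed.

Lemma convex_setP (A : set 'rV[R]_n) (x y : 'rV[R]_n) (t : R) :
  @convex_set R 'rV[R]_n A -> A x -> A y -> 0 <= t <= 1 ->
  A (t *: x + (1 - t) *: y).
Proof.
move=> cA /mem_set Ax /mem_set Ay t01.
have t01' : Itv.spec (@Itv.num_sem R) (Itv.Real `[0%Z, 1%Z]) t.
  by rewrite /= /Itv.num_sem/= num_real.
have := cA x y (Itv.mk t01') Ax Ay.
by move/set_mem.
Qed.

(* A positive combination of the a - s0 and of generators is either a nonzero
   element of the cone or lam *: (p - s0) with p in the convex set. *)
Lemma posspan_shift (A : seq 'rV[int]_n) (s0 : 'rV[int]_n) :
  nonneg_generators b -> (forall i, b i != 0) ->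
  ~ Gamma_plus R b [set` A] (toR R s0) ->
  ~ posspan ([seq b i | i : 'I_r] ++ [seq a - s0 | a <- A]) 0.
Proof.
move=> b0 bN0 nG W0; apply: nG => B [cB AB].
(* [B] is an arbitrary convex set containing the generating points of the hull. Unlike [B], the set
   [B'] is visibly stable under adding the cone; it is still convex and contains every [a]. *)
pose B' : set 'rV[R]_n := [set p | forall y, cone R b y -> B (p + y)].
have B'D p y : B' p -> cone R b y -> B' (p + y).
  by move=> Bp cy z cz; rewrite -addrA; apply: Bp; exact: coneD.
have B'cvx p q t : B' p -> B' q -> 0 <= t <= 1 -> B' (t *: p + (1 - t) *: q).
  move=> Bp Bq t01 y cy.
  have -> : t *: p + (1 - t) *: q + y = t *: (p + y) + (1 - t) *: (q + y).
    by rewrite !scalerDr addrACA -scalerDl (addrC t) subrK scale1r.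
  by apply: convex_setP => //; [exact: Bp|exact: Bq].
(* The coordinate sum certifies that the cone alternative in [key] never produces 0. *)
pose sg := dot (const_mx 1 : 'cV[int]_n).
have key u : posspan ([seq b i | i : 'I_r] ++ [seq a - s0 | a <- A]) u ->
    (cone R b (toR R u) /\ 0 < sg u) \/
    exists lam p, [/\ 0 < lam, B' p & toR R u = lam *: (p - toR R s0)].
  elim=> [v|v w _ IHv _ IHw].
    rewrite mem_cat => /orP[/mapP[i _ ->]|/mapP[a aA ->]].
      by left; split; [exact: cone_gen|exact: gen_dot_gt0].
    right; exists 1, (toR R a); split=> //; last by rewrite toRB scale1r.
    by move=> y cy; apply: AB; exists a, y.
  case: IHv IHw => [[cv sv]|[lam [p [lam0 Bp Ev]]]] [[cw sw]|[mu [q [mu0 Bq Ew]]]].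
  - by left; rewrite toRD /sg dotDr addr_gt0 //; split=> //; exact: coneD.
  - right; exists mu, (q + mu^-1 *: toR R v); split=> //.
      by apply: B'D => //; apply: coneZ => //; rewrite invr_ge0 ltW.
    by rewrite toRD Ew !scalerDr scalerA divff ?gt_eqF // scale1r addrCA addrA.
  - right; exists lam, (p + lam^-1 *: toR R w); split=> //.
      by apply: B'D => //; apply: coneZ => //; rewrite invr_ge0 ltW.
    by rewrite toRD Ev !scalerDr scalerA divff ?gt_eqF // scale1r addrAC.
  - right; have S0 : 0 < lam + mu by rewrite addr_gt0.
    exists (lam + mu), ((lam / (lam + mu)) *: p + (1 - lam / (lam + mu)) *: q).
    split=> //.
      apply: B'cvx => //; apply/andP; split; first by rewrite divr_ge0 // ltW.
      by rewrite ler_pdivrMr // mul1r lerDl ltW.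
    rewrite toRD Ev Ew !scalerBr scalerDr !scalerA scalerDl opprD addrACA.
    have E1 : (lam + mu) * (lam / (lam + mu)) = lam by field; rewrite gt_eqF.
    have E2 : (lam + mu) * (1 - lam / (lam + mu)) = mu by field; rewrite gt_eqF.
    by rewrite E1 E2.
have [[_]|[lam [p [lam0 Bp]]]] := key _ W0.
  by rewrite /sg dot0r ltxx.
rewrite /toR map_mx0 => /esym/eqP; rewrite scaler_eq0 gt_eqF //= subr_eq0.
by move=> /eqP <-; rewrite -[p]addr0; apply: Bp; exact: cone0.
Qed.

End Convexity.

(** * Orders of vanishing along a curve *)

Section ComplexModulus.
Variable R : realType.
Implicit Types z : R[i].

(** The norm on [R[i]] takes values in [R[i]]; this real-valued modulus keeps the estimates in
    [R]. *)
Definition cabs z : R := complex.Re `|z|.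

Lemma normCE z : `|z| = (cabs z)%:C.
Proof. by rewrite /cabs normc_def. Qed.

Lemma cabs_ge0 z : 0 <= cabs z.
Proof. by rewrite -ler0c -normCE normr_ge0. Qed.

Lemma cabs0 : cabs 0 = 0.
Proof. by apply: complexI; rewrite -normCE normr0. Qed.

Lemma cabsM z1 z2 : cabs (z1 * z2) = cabs z1 * cabs z2.
Proof. by apply: complexI; rewrite rmorphM -!normCE normrM. Qed.

Lemma cabsN z : cabs (- z) = cabs z.
Proof. by apply: complexI; rewrite -!normCE normrN. Qed.

Lemma cabsX z n : cabs (z ^+ n) = cabs z ^+ n.
Proof. by apply: complexI; rewrite rmorphXn -!normCE normrX. Qed.

Lemma cabsD z1 z2 : cabs (z1 + z2) <= cabs z1 + cabs z2.
Proof. by rewrite -lecR rmorphD -!normCE ler_normD. Qed.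

Lemma cabs_sum I (s : seq I) (P : pred I) (F : I -> R[i]) :
  cabs (\sum_(i <- s | P i) F i) <= \sum_(i <- s | P i) cabs (F i).
Proof.
elim/big_rec2: _ => [|i x y _ xy]; first by rewrite cabs0.
by apply: le_trans (cabsD _ _) _; rewrite lerD2l.
Qed.

Lemma cabs_real (t : R) : 0 <= t -> cabs t%:C = t.
Proof. by move=> t0; apply: complexI; rewrite -normCE ger0_norm // ler0c. Qed.

Lemma cabs_gt0 z : (0 < cabs z) = (z != 0).
Proof. by rewrite -normr_gt0 normCE -ltcR. Qed.

End ComplexModulus.

Section PowerBound.
Variable R : realType.
Implicit Types (phi psi : R -> R[i]) (c : nat).

Definition Opow c phi :=
  exists K : R, \forall t \near 0^'+, cabs (phi t) <= K * t ^+ c.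

Lemma Opow_near c phi psi :
  (\forall t \near 0^'+, phi t = psi t) -> Opow c phi -> Opow c psi.
Proof.
by move=> E [K H]; exists K; near=> t; rewrite -(near E t) //; near: t.
Unshelve. all: by end_near. Qed.

Lemma Opow_ge0 c phi : Opow c phi ->
  exists2 K : R, 0 <= K & \forall t \near 0^'+, cabs (phi t) <= K * t ^+ c.
Proof.
move=> [K H]; exists `|K| => //; near=> t; apply: le_trans (near H t _) _ => //.
by rewrite ler_wpM2r ?exprn_ge0 ?ler_norm // ltW.
Unshelve. all: by end_near. Qed.

Lemma Opow0 c : Opow c (fun=> 0).
Proof. by exists 0; near=> t; rewrite mul0r cabs0. Unshelve. all: by end_near. Qed.

Lemma OpowD c phi psi :
  Opow c phi -> Opow c psi -> Opow c (fun t => phi t + psi t).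
Proof.
move=> [K HK] [L HL]; exists (K + L); near=> t.
apply: le_trans (cabsD _ _) _; rewrite mulrDl lerD //.
  exact: (near HK t).
exact: (near HL t).
Unshelve. all: by end_near. Qed.

Lemma OpowN c phi : Opow c phi -> Opow c (fun t => - phi t).
Proof.
by move=> [K HK]; exists K; near=> t; rewrite cabsN; exact: (near HK t).
Unshelve. all: by end_near. Qed.

Lemma OpowM c d phi psi :
  Opow c phi -> Opow d psi -> Opow (c + d) (fun t => phi t * psi t).
Proof.
move=> /Opow_ge0[K K0 HK] /Opow_ge0[L L0 HL]; exists (K * L); near=> t.
rewrite cabsM exprD mulrACA ler_pM ?cabs_ge0 //.
  exact: (near HK t).
exact: (near HL t).
Unshelve. all: by end_near. Qed.

Lemma Opow_sum c I (s : seq I) (F : I -> R -> R[i]) :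
  (forall i, Opow c (F i)) -> Opow c (fun t => \sum_(i <- s) F i t).
Proof.
move=> H; elim: s => [|i s IH].
  by apply: Opow_near (Opow0 c); near=> t; rewrite big_nil.
by apply: Opow_near (OpowD (H i) IH); near=> t; rewrite big_cons.
Unshelve. all: by end_near. Qed.

Lemma Opow_prod c I (s : seq I) (F : I -> R -> R[i]) :
  (forall i, Opow c (F i)) -> Opow (size s * c) (fun t => \prod_(i <- s) F i t).
Proof.
move=> H; elim: s => [|i s IH].
  exists 1; near=> t; rewrite big_nil expr0 mulr1.
  by rewrite -[1 : R[i]]/(1%:C) cabs_real.
by rewrite mulSn; apply: Opow_near (OpowM (H i) IH); near=> t; rewrite big_cons.
Unshelve. all: by end_near. Qed.

Lemma Opow_leq c d phi : (d <= c)%N -> Opow c phi -> Opow d phi.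
Proof.
move=> dc /Opow_ge0[K K0 HK]; exists K; near=> t.
apply: le_trans (near HK t _) _ => //; rewrite ler_wpM2l //.
by rewrite ler_wiXn2l //; near: t; exact: nbhs_right_ltW.
Unshelve. all: by end_near. Qed.

Lemma Opow_monomial c (z : R[i]) : Opow c (fun t => z * t%:C ^+ c).
Proof.
exists (cabs z); near=> t; rewrite cabsM cabsX cabs_real //.
Unshelve. all: by end_near. Qed.

(** The lowest nonzero term would dominate: once the lower coefficients vanish, [A d * t ^ d] is
    O(t^(d+1)), so the modulus of [A d] is at most [K * t] for all small [t]. *)
Lemma Opow_coef_eq0 c (A : nat -> R[i]) :
  Opow c (fun t => \sum_(d < c) A d * t%:C ^+ d) ->
  forall d, (d < c)%N -> A d = 0.
Proof.
move=> H d; have [m] := ubnP d; elim: m d => // m IH d dm dc.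
have dH : Opow d.+1 (fun t => A d * t%:C ^+ d).
  have H1 : Opow d.+1 (fun t => \sum_(e < c | (d < e)%N) A e * t%:C ^+ e).
    pose F (e : 'I_c) t := if (d < e)%N then A e * t%:C ^+ e else 0.
    have FO e : Opow d.+1 (F e).
      rewrite /F; case: (boolP (d < e)%N) => de; last exact: Opow0.
      exact: Opow_leq de (Opow_monomial _ _).
    apply: Opow_near (Opow_sum (index_enum 'I_c) FO).
    by near=> t; rewrite [RHS]big_mkcond.
  apply: Opow_near (OpowD (Opow_leq dc H) (OpowN H1)); near=> t.
  rewrite (bigID (fun e : 'I_c => (d < e)%N)) /= addrAC subrr add0r.
  rewrite (bigD1 (Ordinal dc)) ?ltnn //= big1 ?addr0 // => e /andP[].
  rewrite -leqNgt leq_eqVlt => /predU1P[ed|ed] ne.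
    by case/eqP: ne; exact: val_inj.
  by rewrite IH ?mul0r // (leq_trans ed) // -ltnS.
apply/eqP/negPn/negP; rewrite -cabs_gt0 => A0.
have /Opow_ge0[K K0 HK] := dH.
suff : \forall t \near (0 : R)^'+, False by move=> /filter_ex[].
near=> t; have t0 : 0 < t by near: t; exact: nbhs_right_gt.
have t0' := ltW t0.
have : cabs (A d) <= K * t.
  have : cabs (A d * t%:C ^+ d) <= K * t ^+ d.+1 by exact: (near HK t).
  by rewrite cabsM cabsX cabs_real // exprS mulrA ler_pM2r ?exprn_gt0.
apply/negP; rewrite -ltNge.
apply: (@le_lt_trans _ _ ((K + 1) * t)); first by rewrite ler_wpM2r ?ltW ?ltrDl.
rewrite mulrC -ltr_pdivlMr ?ltr_wpDl //.
by near: t; apply: nbhs_right_lt; rewrite divr_gt0 // ltr_wpDl.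
Unshelve. all: by end_near. Qed.

(** Let y be the modulus of [phi t] and suppose y > (1 + K m) t^c. Then t^c <= y, so each term
    satisfies K t^(ic) y^(m-i) <= K t^c y^(m-1). Summing and dividing by y^(m-1) gives y <= K m t^c,
    a contradiction. *)
Lemma Opow_root c m (a : nat -> R -> R[i]) phi : (0 < m)%N ->
  (forall i, (1 <= i <= m)%N -> Opow (i * c) (a i)) ->
  (\forall t \near 0^'+,
     phi t ^+ m + \sum_(1 <= i < m.+1) a i t * phi t ^+ (m - i) = 0) ->
  Opow c phi.
Proof.
move=> m0 aO E.
have [K K0 HK] : exists2 K : R, 0 <= K & \forall t \near 0^'+,
    forall i, (1 <= i <= m)%N -> cabs (a i t) <= K * t ^+ (i * c).
  have /choice[K KP] : forall i : 'I_m, exists K : R, 0 <= K /\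
      \forall t \near 0^'+, cabs (a i.+1 t) <= K * t ^+ (i.+1 * c).
    move=> i; have /Opow_ge0[K K0 HK] := aO i.+1 (ltn_ord i).
    by exists K.
  exists (\sum_i K i) => [|]; first by apply: sumr_ge0 => i _; case: (KP i).
  have H : \forall t \near (0 : R)^'+, forall i : 'I_m,
      cabs (a i.+1 t) <= K i * t ^+ (i.+1 * c).
    by apply: filter_forall => i; case: (KP i).
  near=> t => -[//|i] /= im.
  have Hi : cabs (a i.+1 t) <= K (Ordinal im) * t ^+ (i.+1 * c).
    exact: (near H t _ (Ordinal im)).
  apply: le_trans Hi _; rewrite ler_wpM2r ?exprn_ge0 //.
  rewrite (bigD1 (Ordinal im)) //= lerDl.
  by apply: sumr_ge0 => j _; case: (KP j).
exists (1 + K * m%:R); near=> t.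
have t0 : 0 < t by near: t; exact: nbhs_right_gt.
have tc0 : 0 < t ^+ c by rewrite exprn_gt0.
have Et : phi t ^+ m = - \sum_(1 <= i < m.+1) a i t * phi t ^+ (m - i).
  by apply/eqP; rewrite -addr_eq0; apply/eqP; exact: (near E t).
have aK i : (1 <= i <= m)%N -> cabs (a i t) <= K * t ^+ (i * c).
  exact: (near HK t).
set y := cabs (phi t); have y0 : 0 <= y by exact: cabs_ge0.
rewrite leNgt; apply/negP => yt.
have ty : t ^+ c <= y.
  by apply: le_trans (ltW yt); rewrite ler_peMl ?(ltW tc0) // lerDl mulr_ge0.
have : y ^+ m <= (K * m%:R) * t ^+ c * y ^+ m.-1.
  rewrite -cabsX Et cabsN (le_trans (cabs_sum _ _ _)) //.
  have -> : K * m%:R * t ^+ c * y ^+ m.-1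
      = \sum_(1 <= i < m.+1) K * t ^+ c * y ^+ m.-1.
    by rewrite sumr_const_nat subn1 /= -mulr_natr; ring.
  rewrite big_nat_cond [leRHS]big_nat_cond; apply: ler_sum => i.
  rewrite andbT => /andP[i1 im].
  rewrite ltnS in im; rewrite cabsM cabsX -/y.
  apply: (@le_trans _ _ (K * t ^+ (i * c) * y ^+ (m - i))).
    by rewrite ler_wpM2r ?exprn_ge0 // aK // i1.
  rewrite -!mulrA ler_wpM2l //.
  have -> : m.-1 = (i.-1 + (m - i))%N by lia.
  rewrite exprD mulrA ler_wpM2r ?exprn_ge0 //.
  rewrite -(prednK i1) mulSn exprD ler_wpM2l ?(ltW tc0) //= mulnC exprM.
  by rewrite lerXn2r // nnegrE (ltW tc0).
have ym0 : 0 < y ^+ m.-1 by rewrite exprn_gt0 // (lt_le_trans tc0).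
rewrite -{1}(prednK m0) exprS ler_pM2r // leNgt => /negP; apply.
by apply: le_lt_trans yt; rewrite mulrDl mul1r lerDr ltW.
Unshelve. all: by end_near. Qed.

(** Convergence at one point [t0] bounds all [A d * t0 ^ d]; for [t <= t0 / 2] the tail is then
    dominated by a geometric series of ratio at most 1/2. *)
Lemma Opow_series_tail c (A : nat -> R[i]) phi :
  (\forall t \near 0^'+,
     (fun N => \sum_(d < N) A d * t%:C ^+ d) @ \oo --> phi t) ->
  Opow c (fun t => phi t - \sum_(d < c) A d * t%:C ^+ d).
Proof.
move=> Hcv; pose S t N := \sum_(d < N) A d * t%:C ^+ d.
have close t (e : R) : 0 < e -> S t @ \oo --> phi t ->
    exists N0, forall N, (N0 <= N)%N -> cabs (phi t - S t N) < e.
  move=> e0 /cvgrPdist_lt /(_ e%:C); rewrite ltcR => /(_ e0)[N0 _ HN].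
  by exists N0 => N /HN /=; rewrite normCE ltcR.
have [t0 t00 [M M0 HM]] : exists2 t0 : R, 0 < t0 &
    exists2 M : R, 0 <= M & forall d, cabs (A d) * t0 ^+ d <= M.
  have : \forall t \near (0 : R)^'+, 0 < t /\ S t @ \oo --> phi t.
    by apply: filterI => //; exact: nbhs_right_gt.
  move=> /filter_ex[t0 [t00 /(close t0 1 ltr01)[N0 HN0]]].
  have t00' := ltW t00; exists t0 => //.
  (* The sum covers [d < N0]; beyond, a term is the difference of two partial sums, each within 1 of
     the limit. *)
  exists (2 + \sum_(d < N0) cabs (A d) * t0 ^+ d).
    rewrite addr_ge0 // sumr_ge0 // => d _.
    by rewrite mulr_ge0 ?cabs_ge0 ?exprn_ge0.
  move=> d; have [dN|Nd] := ltnP d N0.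
    rewrite (bigD1 (Ordinal dN)) //= addrCA lerDl addr_ge0 // sumr_ge0 // => e _.
    by rewrite mulr_ge0 ?cabs_ge0 ?exprn_ge0.
  apply: (@le_trans _ _ 2); last first.
    rewrite lerDl sumr_ge0 // => e _.
    by rewrite mulr_ge0 ?cabs_ge0 ?exprn_ge0.
  have -> : cabs (A d) * t0 ^+ d = cabs (S t0 d.+1 - S t0 d).
    by rewrite /S big_ord_recr /= addrAC subrr add0r cabsM cabsX cabs_real.
  have -> : S t0 d.+1 - S t0 d = (phi t0 - S t0 d) - (phi t0 - S t0 d.+1) by ring.
  apply: le_trans (cabsD _ _) _; rewrite cabsN.
  by rewrite -[2]/(1 + 1 : R) lerD // ltW // HN0 // ltnW.
have bound t n : 0 < t -> t <= t0 / 2 ->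
    cabs (S t (c + n)%N - S t c) <= 2 * M / t0 ^+ c * t ^+ c.
  move=> tgt0 tle; have tge0 := ltW tgt0; pose q := t / t0.
  have q0 : 0 <= q by rewrite divr_ge0 // ltW.
  have q2 : q <= 2^-1 by rewrite ler_pdivrMr // mulrC.
  (* The bound telescopes: a new term is at most [M * q ^+ (c + n)], and [2 * (1 - q) >= 1]. *)
  have H : cabs (S t (c + n)%N - S t c) <= 2 * M * (q ^+ c - q ^+ (c + n)).
    elim: n => [|n IH]; first by rewrite addn0 !subrr cabs0 mulr0.
    rewrite addnS /S big_ord_recr /= -/(S t (c + n)%N) -/(S t c) addrAC.
    apply: le_trans (cabsD _ _) _.
    have -> : 2 * M * (q ^+ c - q ^+ (c + n).+1) =
       2 * M * (q ^+ c - q ^+ (c + n)) + M * q ^+ (c + n) * (2 * (1 - q)).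
      by rewrite exprS; ring.
    apply: lerD; first exact: IH.
    rewrite cabsM cabsX cabs_real //.
    have -> : t = q * t0 by rewrite /q divfK // lt0r_neq0.
    rewrite exprMn mulrCA mulrC -[leLHS]mulr1.
    apply: ler_pM => //; first by rewrite !mulr_ge0 ?exprn_ge0 ?cabs_ge0 ?(ltW t00).
      by rewrite ler_wpM2r ?exprn_ge0.
    lra.
  apply: le_trans H _; rewrite -!mulrA ler_wpM2l // ler_wpM2l //.
  by rewrite /q expr_div_n mulrC lerBlDr lerDl exprn_ge0.
exists (1 + 2 * M / t0 ^+ c); near=> t.
have tgt0 : 0 < t by near: t; exact: nbhs_right_gt.
have tle : t <= t0 / 2 by near: t; apply: nbhs_right_ltW; rewrite divr_gt0.
(* The truncation index may depend on [t], since [bound] is uniform in it; this error accounts for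
   the 1 in the constant. *)
have [|N0 HN0] := close t (t ^+ c) (exprn_gt0 _ tgt0).
  exact: (near Hcv t).
have -> : phi t - \sum_(d < c) A d * t%:C ^+ d
   = (phi t - S t (c + N0)%N) + (S t (c + N0)%N - S t c) by rewrite addrA subrK.
apply: le_trans (cabsD _ _) _; rewrite mulrDl mul1r lerD ?bound //.
by rewrite ltW // HN0 // leq_addl.
Unshelve. all: by end_near. Qed.

End PowerBound.

(** * Restriction of power series to monomial curves *)

Section Curve.
Variables (R : realType) (r : nat).
Local Notation C := R[i].
Implicit Types (w : 'I_r -> nat) (k : {ffun 'I_r -> nat}) (t : R).

Definition wdeg w k : nat := \sum_i w i * k i.

Definition curve w t : 'rV[C]_r := \row_i t%:C ^+ w i.

Lemma monomial_curve w t k : monomial k (curve w t) = t%:C ^+ wdeg w k.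
Proof.
rewrite /monomial /wdeg expr_sum; apply: eq_bigr => i _.
by rewrite mxE exprM.
Qed.

Lemma curve_near w (P : set 'rV[C]_r) : (forall i, (0 < w i)%N) ->
  (\forall x \near (0 : 'rV[C]_r), P x) -> \forall t \near 0^'+, P (curve w t).
Proof.
move=> w0 /nbhs_ballP[e /= e0 eP].
(* The radius is a positive element of [R[i]], hence real. *)
have [eR e0R] : e = (complex.Re e)%:C /\ 0 < complex.Re e.
  have E : e = (complex.Re e)%:C by rewrite RRe_real // gtr0_real.
  by split=> //; rewrite -ltcR -E.
near=> t; apply: eP; split=> // i j; rewrite !mxE -ball_normE /= sub0r normrN.
have t0 : 0 < t by near: t; exact: nbhs_right_gt.
rewrite normCE cabsX cabs_real ?(ltW t0) // eR ltcR.
have t1 : t <= 1 by near: t; exact: nbhs_right_ltW.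
apply: (@le_lt_trans _ _ t); last by near: t; exact: nbhs_right_lt.
by rewrite -[leRHS]expr1 ler_wiXn2l // (ltW t0).
Unshelve. all: by end_near. Qed.

(** Meaningful for finite [K] only: [fset_set] sends an infinite set to the empty one. *)
Definition coefs_sum (a : {ffun 'I_r -> nat} -> C)
    (K : set {ffun 'I_r -> nat}) : C :=
  \sum_(k <- fset_set K) a k.

Definition wcoef w a d := coefs_sum a [set k | wdeg w k = d].

Lemma finite_wdeg_le w N : (forall i, (0 < w i)%N) ->
  finite_set [set k | (wdeg w k <= N)%N].
Proof.
move=> w0.
apply: sub_finite_set (finite_seq
  [seq [ffun i => nat_of_ord (k i)] | k : {ffun 'I_r -> 'I_N.+1}]) => k /= kN.
apply/mapP; exists [ffun i => inord (k i)]; first by rewrite mem_enum.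
apply/ffunP => i; rewrite !ffunE inordK // ltnS (leq_trans _ kN) //.
by rewrite /wdeg (bigD1 i) //= (leq_trans _ (leq_addr _ _)) // leq_pmull.
Qed.

Lemma finite_wdeg_eq w d : (forall i, (0 < w i)%N) ->
  finite_set [set k | wdeg w k = d].
Proof.
by move=> w0; apply: sub_finite_set (finite_wdeg_le d w0) => k /= ->.
Qed.

Lemma sum_wdeg_le w a t N : (forall i, (0 < w i)%N) ->
  \sum_(k <- fset_set [set k | (wdeg w k <= N)%N]) a k * monomial k (curve w t) =
  \sum_(d < N.+1) wcoef w a d * t%:C ^+ d.
Proof.
move=> w0; rewrite big_seq.
rewrite (partition_big (fun k => inord (wdeg w k) : 'I_N.+1) predT) //=.
apply: eq_bigr => d _; rewrite /wcoef /coefs_sum mulr_suml.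
rewrite -big_filter [RHS]big_seq -[RHS]big_filter.
have mle k : (k \in fset_set [set k | (wdeg w k <= N)%N]) = (wdeg w k <= N)%N.
  by rewrite in_fset_set ?inE //; [apply/idP/idP; rewrite inE|exact: finite_wdeg_le].
have meq k : (k \in fset_set [set k | wdeg w k = d]) = (wdeg w k == d).
  rewrite in_fset_set; last exact: finite_wdeg_eq.
  by apply/idP/eqP; rewrite inE.
transitivity (\sum_(k <- [seq k <- fset_set [set k | wdeg w k = d] |
     k \in fset_set [set k | wdeg w k = d]]) a k * monomial k (curve w t)).
  apply: perm_big; apply: uniq_perm; rewrite ?filter_uniq ?fset_uniq // => k.
  rewrite !mem_filter !mle !meq andbb andbAC andbb.
  apply/andP/eqP => [[kN /eqP <-]|E]; first by rewrite inordK.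
  by rewrite E -ltnS ltn_ord; split=> //; apply/eqP/val_inj; rewrite /= inordK.
rewrite !big_filter; apply: eq_bigr => k.
by rewrite meq monomial_curve => /eqP ->.
Qed.

Lemma partial_sumE (I : choiceType) (F : I -> C) (J : {fset I}) :
  summability.partial_sum F J = \sum_(i <- J) F i.
Proof. by rewrite /summability.partial_sum big_seq_fsetE. Qed.

(** The finite sets of exponents of weight at most [N] are cofinal among all finite sets, so
    unconditional convergence yields convergence of the series in [t] grouped by weight. *)
Lemma taylor_curve w f a (c : nat) : (forall i, (0 < w i)%N) -> taylor_at0 f a ->
  Opow c (fun t => f (curve w t) - \sum_(d < c) wcoef w a d * t%:C ^+ d).
Proof.
move=> w0 /(curve_near w0) fa.
apply: (Opow_series_tail _ (phi := fun t => f (curve w t))).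
apply: filterS fa => t cvt.
rewrite -cvg_shiftS /=.
under eq_fun do rewrite -(sum_wdeg_le _ _ _ w0) -partial_sumE.
apply: cvg_comp cvt => A [B _ BA].
exists (\max_(k <- B) wdeg w k) => // N /= BN; apply: BA => /=.
apply/fsubsetP => k kB; rewrite in_fset_set; last exact: finite_wdeg_le.
by rewrite inE /=; apply: leq_trans BN; exact: leq_bigmax_seq.
Qed.

Lemma Opow_taylor w f a (c : nat) : (forall i, (0 < w i)%N) -> taylor_at0 f a ->
  Opow c (fun t => f (curve w t)) <-> forall d, (d < c)%N -> wcoef w a d = 0.
Proof.
move=> w0 fa; have H := taylor_curve c w0 fa; split=> [fO|a0].
  apply: Opow_coef_eq0; apply: Opow_near (OpowD fO (OpowN H)).
  by near=> t; rewrite opprB addrC subrK.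
apply: Opow_near H; near=> t; rewrite big1 ?subr0 // => d _.
by rewrite a0 ?mul0r.
Unshelve. all: by end_near. Qed.

End Curve.

(** * Weights that isolate a fiber of [degS] *)

Lemma separating_weight n r (b : 'I_r -> 'rV[int]_n) s0 :
  nonneg_generators b -> (forall i, b i != 0) ->
  exists2 l, forall i, 0 < dot l (b i) &
    forall k, dot l (degS b k) = dot l s0 -> degS b k = s0.
Proof.
move=> b0 bN0; pose V := [seq b i | i : 'I_r].
have bV i : b i \in V by apply/mapP; exists i; rewrite ?mem_enum.
have [|l lV ls] := @separation _ _ b V s0 bV; last first.
  by exists l => [i|]; [exact: lV|exact: ls].
suff /posspan_dot_gt0 H : forall v, v \in V -> 0 < dot (const_mx 1) v.
  by move=> /H; rewrite dot0r ltxx.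
by move=> _ /mapP[i _ ->]; exact: gen_dot_gt0.
Qed.

Section Fibers.
Variables (n r : nat) (b : 'I_r -> 'rV[int]_n).

Definition weight (l : 'cV[int]_n) (i : 'I_r) : nat := `|dot l (b i)|%N.

Variable l : 'cV[int]_n.
Hypothesis lb : forall i, 0 < dot l (b i).

Lemma weight_gt0 i : (0 < weight l i)%N.
Proof. by rewrite /weight absz_gt0 gt_eqF. Qed.

Lemma weightE i : (weight l i)%:Z = dot l (b i).
Proof. by rewrite /weight gtz0_abs. Qed.

Lemma wdeg_weight k : (wdeg (weight l) k)%:Z = dot l (degS b k).
Proof.
rewrite degSE /wdeg -natz natr_sum; apply: eq_bigr => i _.
by rewrite natrM !natz weightE.
Qed.

Lemma wdeg_fiber k k' :
  degS b k = degS b k' -> wdeg (weight l) k = wdeg (weight l) k'.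
Proof. by move=> E; apply/eqP; rewrite -eqz_nat !wdeg_weight E. Qed.

End Fibers.

Definition fiber n r (b : 'I_r -> 'rV[int]_n) s := [set k | degS b k = s].

Lemma finite_fiber n r (b : 'I_r -> 'rV[int]_n) s :
  nonneg_generators b -> (forall i, b i != 0) -> finite_set (fiber b s).
Proof.
move=> b0 bN0; have [l lb _] := separating_weight s b0 bN0.
apply: sub_finite_set (finite_wdeg_eq `|dot l s|%N (weight_gt0 lb)) => k /= <-.
by rewrite -wdeg_weight.
Qed.

(** * Germs on the toric variety *)

Section Toric.
Variables (R : realType) (n r : nat) (b : 'I_r -> 'rV[int]_n).
Local Notation C := R[i].
Local Notation X := (@toric_variety R n r b).
Implicit Types (f g h : 'rV[C]_r -> C) (a : {ffun 'I_r -> nat} -> C).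

Lemma meval_poly_monomial (x : 'rV[C]_r) e :
  mpoly.meval (fun i => x ord0 i) (poly_monomial R e) = \prod_i x ord0 i ^+ e i.
Proof.
rewrite /poly_monomial rmorph_prod /=; apply: eq_bigr => i _.
by rewrite rmorphXn /= mpoly.mevalXU.
Qed.

(** Applying [l] to a relation among the [b i] shows that both monomials of the binomial restrict to
    the same power of [t]. *)
Lemma curve_toric l t : (forall i, 0 < dot l (b i)) -> X (curve (weight b l) t).
Proof.
move=> lb p [m [c [g [gI ->]]]]; rewrite rmorph_sum /= big1 // => j _.
rewrite rmorphM /=; have [alpha Ea ->] := gI j.
rewrite rmorphB /= !meval_poly_monomial.
have E e : \prod_i (curve (weight b l) t) ord0 i ^+ e i =
    t%:C ^+ (\sum_i weight b l i * e i)%N.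
  by rewrite expr_sum; apply: eq_bigr => i _; rewrite mxE exprM.
rewrite !E; set p1 := (\sum_i _)%N; set p2 := (\sum_i _)%N.
suff -> : p1 = p2 by rewrite subrr mulr0.
have Ez e : (\sum_i weight b l i * e i)%N%:Z = \sum_i dot l (b i) * (e i)%:Z.
  rewrite -natz natr_sum; apply: eq_bigr => i _.
  by rewrite natrM !natz weightE.
apply/eqP; rewrite -eqz_nat -subr_eq0 !Ez -sumrB.
have E0 : \sum_i dot l (alpha i *: b i) = 0 by rewrite -dot_sumr Ea dot0r.
apply/eqP; apply: etrans E0; apply: eq_bigr => i _.
rewrite dotZr -mulrBr mulrC; congr (_ * _).
by rewrite /pos_part /neg_part; lia.
Qed.

(** Factoring out the monomial of exponent [minn (k i) (k' i)] leaves the two sides of a generator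
    of the toric ideal, so no coordinate has to be inverted. *)
Lemma monomial_toric x k k' : X x -> degS b k = degS b k' ->
  monomial k x = monomial k' x.
Proof.
move=> Xx E; pose alpha i : int := (k i)%:Z - (k' i)%:Z.
have Ea : \sum_i alpha i *: b i = 0.
  under eq_bigr do rewrite /alpha scalerBl -!natz !scaler_nat.
  by rewrite sumrB -/(degS b k) -/(degS b k') E subrr.
have := Xx (poly_monomial R (pos_part alpha) - poly_monomial R (neg_part alpha)).
rewrite rmorphB /= !meval_poly_monomial => H.
have {}H : \prod_i x ord0 i ^+ pos_part alpha i =
           \prod_i x ord0 i ^+ neg_part alpha i.
  apply/eqP; rewrite -subr_eq0; apply/eqP/H.
  exists 1%N, (fun=> 1), (fun=>
    poly_monomial R (pos_part alpha) - poly_monomial R (neg_part alpha)).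
  by split=> [_|]; [exists alpha|rewrite big_ord1 mul1r].
have split_min (k1 : {ffun 'I_r -> nat}) (e : 'I_r -> nat) :
    (forall i, k1 i = minn (k i) (k' i) + e i)%N ->
    monomial k1 x =
      (\prod_i x ord0 i ^+ minn (k i) (k' i)) * \prod_i x ord0 i ^+ e i.
  by move=> Ek; rewrite -big_split; apply: eq_bigr => i _; rewrite Ek exprD.
rewrite (split_min k (pos_part alpha)) ?(split_min k' (neg_part alpha)) ?H //.
  by move=> i; rewrite /neg_part /alpha; lia.
by move=> i; rewrite /pos_part /alpha; lia.
Qed.

Lemma coefs_sumB a a' K :
  coefs_sum (fun k => a k - a' k) K = coefs_sum a K - coefs_sum a' K.
Proof. by rewrite /coefs_sum sumrB. Qed.

Lemma coefs_sum0 a (K : set {ffun 'I_r -> nat}) : finite_set K ->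
  (forall k, K k -> a k = 0) -> coefs_sum a K = 0.
Proof.
move=> finK aK; rewrite /coefs_sum big_seq big1 // => k.
by rewrite in_fset_set // inE => /aK.
Qed.

Lemma coefs_sum_fibers a (K : set {ffun 'I_r -> nat}) : finite_set K ->
  (forall k k', K k -> degS b k = degS b k' -> K k') ->
  (forall k, K k -> coefs_sum a (fiber b (degS b k)) = 0) -> coefs_sum a K = 0.
Proof.
move=> finK clK a0.
have memK k : (k \in fset_set K) <-> K k by rewrite in_fset_set // inE.
rewrite /coefs_sum (partition_big_imfset _ (degS b)) big_seq big1 //= => s.
move=> /imfsetP[k0 /= /memK Kk0 ->].
rewrite -[RHS](a0 _ Kk0) /coefs_sum -big_filter; apply: perm_big.
have finF : finite_set (fiber b (degS b k0)).
  by apply: sub_finite_set finK => k /= /esym; exact: clK.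
apply: uniq_perm; rewrite ?filter_uniq ?fset_uniq // => k.
rewrite mem_filter [RHS]in_fset_set //; apply/andP/idP.
  by move=> [/eqP E _]; rewrite inE.
by rewrite inE /fiber /= => E; split; [exact/eqP|apply/memK; apply: clK Kk0 _].
Qed.

Hypothesis b_nonneg : nonneg_generators b.

Lemma germ_curve (P : set 'rV[C]_r) l : (forall i, 0 < dot l (b i)) ->
  (\forall x \near (0 : 'rV[C]_r), X x -> P x) ->
  \forall t \near 0^'+, P (curve (weight b l) t).
Proof.
move=> lb /(curve_near (weight_gt0 lb)); apply: filterS => t; apply.
exact: curve_toric.
Qed.

(** For a weight isolating [s], the fiber is a whole weight level, and its sum is a coefficient of
    [f] along a curve on which [f] vanishes. Applied to differences, this makes fiber sums
    invariants of the germ. *)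
Lemma fiber_vanish f a : (forall i, b i != 0) -> taylor_at0 f a ->
  (\forall x \near (0 : 'rV[C]_r), X x -> f x = 0) ->
  forall s, coefs_sum a (fiber b s) = 0.
Proof.
move=> bN0 fa f0 s.
have [[k0 <-]|nS] := pselect (exists k, degS b k = s); last first.
  apply: coefs_sum0 => [|k ks]; first exact: finite_fiber.
  by case: nS; exists k.
have [l lb ls] := separating_weight (degS b k0) b_nonneg bN0.
pose d := wdeg (weight b l) k0.
have <- : [set k | wdeg (weight b l) k = d] = fiber b (degS b k0).
  apply/seteqP; split=> k /= E; last exact: wdeg_fiber.
  by apply: ls; rewrite -!wdeg_weight // E.
have /(_ d.+1)[H _] := Opow_taylor _ (weight_gt0 lb) fa.
apply: H (ltnSn d); apply: Opow_near (@Opow0 R d.+1).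
by apply: filterS (germ_curve lb f0) => t ->.
Qed.

End Toric.

(** * Operations on Taylor series and uniqueness of coefficients *)

#[local] Instance totally_filter (I : choiceType) : Filter (@summability.totally I).
Proof. exact: (@filter_filter _ _ (@summability.totally_filter I)). Qed.

Section Taylor.
Variables (R : realType) (r : nat).
Local Notation C := R[i].
Implicit Types (f g : 'rV[C]_r -> C) (a : {ffun 'I_r -> nat} -> C).

Lemma taylorB f g a a' : taylor_at0 f a -> taylor_at0 g a' ->
  taylor_at0 (fun x => f x - g x) (fun k => a k - a' k).
Proof.
move=> fa ga; apply: filterS2 fa ga => x cf cg.
apply: (cvg_trans _ (cvgB cf cg (FF := totally_filter _))).
apply: near_eq_cvg.
near=> J; rewrite !fctE !partial_sumE. rewrite -sumrB.
by apply: eq_bigr => k _; rewrite mulrBl.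
Unshelve. all: by end_near. Qed.

Lemma taylor_polynomial a (K : {fset {ffun 'I_r -> nat}}) :
  taylor_at0 (fun x => \sum_(k <- K) a k * monomial k x)
    (fun k => if k \in K then a k else 0).
Proof.
near=> x; apply: cvg_near_cst; exists K => // J /= KJ.
rewrite partial_sumE.
rewrite (eq_bigr (fun k => if k \in K then a k * monomial k x else 0)); last first.
  by move=> k _; case: ifP => // _; rewrite mul0r.
rewrite -big_mkcond -big_filter; apply: perm_big.
apply: uniq_perm; rewrite ?filter_uniq ?fset_uniq // => k.
by rewrite mem_filter; apply/andb_idr => kK; exact: (fsubsetP KJ).
Unshelve. all: by end_near. Qed.

Lemma taylor0 : taylor_at0 (fun=> 0) (fun=> 0 : C) (r := r).
Proof.
near=> x; apply: cvg_near_cst; exists fset0 => // J _ /=.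
by rewrite partial_sumE big1 // => k _; rewrite mul0r.
Unshelve. all: by end_near. Qed.

(* The case b = standard basis of fiber_vanish, where the fibers of degS are
   points. *)
Lemma taylor_unique f a a' : taylor_at0 f a -> taylor_at0 f a' -> a = a'.
Proof.
move=> fa fa'; apply/funext => k0.
pose b (i : 'I_r) : 'rV[int]_r := delta_mx 0 i.
have bE k : degS b k = \row_i (k i)%:Z.
  apply/rowP => j; rewrite summxE mxE (bigD1 j) //= big1 ?addr0 => [|i ij].
    by rewrite mulmxnE mxE !eqxx mulr1n natz.
  by rewrite mulmxnE mxE eqxx eq_sym (negbTE ij) mul0rn.
have b0 : nonneg_generators b by move=> i j; rewrite mxE ler0n.
have bN0 i : b i != 0.
  by apply/eqP => /rowP/(_ i); rewrite !mxE !eqxx.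
have f0 : \forall x \near (0 : 'rV[C]_r), toric_variety b x -> f x - f x = 0.
  by near=> x => _; rewrite subrr.
have := fiber_vanish b0 bN0 (taylorB fa fa') f0 (degS b k0).
have -> : fiber b (degS b k0) = [set k0].
  apply/seteqP; split=> k /= => [E|-> //]; apply/ffunP => i.
  have := congr1 (fun v : 'rV_r => v ord0 i) E; rewrite (bE k) (bE k0) !mxE.
  by move/eqP; rewrite eqz_nat => /eqP.
rewrite /coefs_sum fset_set1 big_seq_fset1 => /eqP.
by rewrite subr_eq0 => /eqP.
Unshelve. all: by end_near. Qed.

End Taylor.

(** * Supports of germs and orders along curves *)

Section Support.
Variables (R : realType) (n r : nat) (b : 'I_r -> 'rV[int]_n).
Local Notation C := R[i].
Local Notation X := (@toric_variety R n r b).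
Implicit Types (f g h : 'rV[C]_r -> C) (a : {ffun 'I_r -> nat} -> C).
Hypothesis b_nonneg : nonneg_generators b.

(* If b i = 0 then x_i = 1 on X(S), which therefore misses a neighbourhood of 0,
   and all germs are equal. *)
Lemma supp_zero_gen h i s : b i = 0 -> ~ supp b h s.
Proof.
move=> bi0 /(_ (fun=> 0))[].
  split; first by exists (fun=> 0); exact: taylor0.
  have : \forall x \near (0 : 'rV[C]_r), `|(x : 'rV[C]_r) ord0 i| < 1.
    apply/nbhs_ballP; exists 1 => //= x [_ /(_ ord0 i)].
    by rewrite mxE -ball_normE /= sub0r normrN.
  apply: filterS => x xi1 Xx; exfalso.
  pose e : {ffun 'I_r -> nat} := [ffun j => (j == i)%N : nat].
  have degE : degS b e = degS b [ffun=> 0%N].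
    rewrite /degS (bigD1 i) //= ffunE eqxx bi0 mul0rn add0r [RHS]big1; last first.
      by move=> j _; rewrite ffunE.
    by rewrite big1 // => j /negbTE ji; rewrite ffunE ji.
  have := monomial_toric Xx degE.
  rewrite /monomial (bigD1 i) //= ffunE eqxx expr1 big1 => [|j /negbTE ji].
    rewrite mulr1 big1 => [|j _]; last by rewrite ffunE.
    by move=> x1; rewrite x1 normr1 ltxx in xi1.
  by rewrite ffunE ji.
move=> a [k [fa ak0 _]].
by move: ak0; rewrite (taylor_unique fa (@taylor0 R r)) eqxx.
Qed.

Hypothesis bN0 : forall i, b i != 0.

(** Some representative has no monomial in the fiber, and all representatives have the same fiber
    sum. *)
Lemma notin_supp g f a s : taylor_at0 f a -> germ_eq b g f ->
  ~ supp b g s -> coefs_sum a (fiber b s) = 0.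
Proof.
move=> fa gf /existsNP[f' /not_implyP[[[a' fa'] gf'] ns]].
have a'0 : coefs_sum a' (fiber b s) = 0.
  apply: coefs_sum0 => [|k ks]; first exact: finite_fiber.
  apply/eqP/negPn/negP => ak; apply: ns; exists a', k.
  by split=> //; rewrite ks.
have ff' : \forall x \near (0 : 'rV[C]_r), X x -> f x - f' x = 0.
  near=> x => Xx; apply/eqP; rewrite subr_eq0; apply/eqP.
  have <- : g x = f x by move: Xx; near: x.
  by move: Xx; near: x.
have := fiber_vanish b_nonneg bN0 (taylorB fa fa') ff' s.
by rewrite coefs_sumB a'0 subr0.
Unshelve. all: by end_near. Qed.

(* If the sum vanishes, dropping from f the monomials of degree s gives a
   representative of the same germ without s in its support. *)
Lemma supp_coefs_sum_neq0 h f a s : taylor_at0 f a -> germ_eq b h f ->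
  supp b h s -> coefs_sum a (fiber b s) != 0.
Proof.
move=> fa hf hs; apply/eqP => a0.
have finF : finite_set (fiber b s) by exact: finite_fiber.
pose K := fset_set (fiber b s).
have memK k : (k \in K) <-> degS b k = s by rewrite in_fset_set // inE.
have [|a' [k [fa' + ks]]] :=
    hs (fun x => f x - \sum_(k <- K) a k * monomial k x).
  split; first by eexists; apply: taylorB fa (taylor_polynomial a K).
  apply: filterS hf => x hfx Xx; rewrite -hfx // [X in _ - X](_ : _ = 0) ?subr0 //.
  have [[k0 k0s]|nS] := pselect (exists k, degS b k = s); last first.
    by rewrite big_seq big1 // => k /memK ks; case: nS; exists k.
  transitivity (\sum_(k <- K) a k * monomial k0 x).
    rewrite big_seq [RHS]big_seq; apply: eq_bigr => k /memK ks.
    by rewrite (monomial_toric Xx (k := k) (k' := k0)) // ks k0s.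
  by rewrite -mulr_suml -/(coefs_sum a (fiber b s)) a0 mul0r.
rewrite (taylor_unique fa' (taylorB fa (taylor_polynomial a K))).
by have /memK -> := esym ks; rewrite subrr eqxx.
Qed.

Lemma suppS g s : OX b g -> supp b g s -> exists k, s = degS b k.
Proof.
move=> [f fan gf] /(_ f (conj fan gf))[a [k [_ _ ->]]].
by exists k.
Qed.

Section Order.
Variable l : 'cV[int]_n.
Hypothesis lb : forall i, 0 < dot l (b i).
Local Notation gam := (curve (weight b l)).

Lemma OX_curve g f a (c : nat) : taylor_at0 f a -> germ_eq b g f ->
  Opow c (fun t => g (gam t)) <->
  forall d, (d < c)%N -> wcoef (weight b l) a d = 0.
Proof.
move=> fa gf; rewrite -(Opow_taylor c (weight_gt0 lb) fa).
have E := germ_curve lb gf.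
by split; apply: Opow_near => //; apply: filterS E => t ->.
Qed.

Lemma Opow0_OX g : OX b g -> Opow 0 (fun t => g (gam t)).
Proof. by move=> [f [a fa] gf]; apply/(OX_curve _ fa gf). Qed.

(** A weight level is a union of fibers; those on a level below [c] lie over degrees outside the
    support, so their sums vanish. *)
Lemma Opow_supp g (c : nat) : OX b g ->
  (forall s, supp b g s -> c%:Z <= dot l s) -> Opow c (fun t => g (gam t)).
Proof.
move=> [f [a fa] gf] cs; apply/(OX_curve _ fa gf) => d dc.
apply: (coefs_sum_fibers (b := b)) => [|k k' /= <- E|k /= kd].
- exact/finite_wdeg_eq/weight_gt0.
- by apply/esym; exact: wdeg_fiber.
- apply: notin_supp fa gf _ => /cs; rewrite -wdeg_weight // kd; lia.
Qed.

Lemma Opow_ideal_gen (G : set ('rV[C]_r -> C)) g (c : nat) :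
  (forall u, G u -> Opow c (fun t => u (gam t))) ->
  ideal_gen b G g -> Opow c (fun t => g (gam t)).
Proof.
move=> Gc [_ [m [d [u [dO uG E]]]]].
have := germ_curve (P := fun x => g x = \sum_(j < m) d j x * u j x) lb E.
move=> {}E; apply: Opow_near (Opow_sum (index_enum 'I_m)
  (fun j => OpowM (Opow0_OX (dO j)) (Gc _ (uG j)))).
by apply: filterS E => t ->.
Qed.

(** A product of [i] elements of [I] is O(t^(ic)), hence so is every element of the ideal power;
    these are the coefficient bounds that [Opow_root] asks for. *)
Lemma Opow_integral (I : set ('rV[C]_r -> C)) h (c : nat) :
  (forall u, I u -> Opow c (fun t => u (gam t))) ->
  integral_closure b I h -> Opow c (fun t => h (gam t)).
Proof.
move=> Ic [_ [m [a [m0 aI E]]]].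
apply: (Opow_root (a := fun i t => a i (gam t)) m0); last first.
  exact: (germ_curve (P := fun x =>
    h x ^+ m + \sum_(1 <= i < m.+1) a i x * h x ^+ (m - i) = 0) lb E).
move=> i /aI; apply: Opow_ideal_gen => _ [u uI ->].
have := Opow_prod (enum 'I_i) (fun j => Ic _ (uI j)); rewrite size_enum_ord.
by apply: Opow_near; near=> t; rewrite big_enum.
Unshelve. all: by end_near. Qed.

Lemma supp_OpowN h s : OX b h -> supp b h s ->
  (forall k, dot l (degS b k) = dot l s -> degS b k = s) ->
  ~ Opow (`|dot l s|%N).+1 (fun t => h (gam t)).
Proof.
move=> hO hs ls; have [k0 Es] := suppS hO hs.
have [f [a fa] hf] := hO.
move=> /(OX_curve _ fa hf)/(_ _ (ltnSn _)) a0.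
have /eqP := supp_coefs_sum_neq0 fa hf hs; apply; rewrite -[RHS]a0.
congr coefs_sum; apply/seteqP; split=> k /= E.
  by rewrite -E -wdeg_weight.
apply: ls; rewrite -wdeg_weight // E {E}Es -wdeg_weight //.
Qed.

End Order.

(** The finite list [A0] spans a smaller polyhedron, so it also misses [s0]. Each member of [A] is
    one of [A0] plus a sum of generators, on which [l] is nonnegative, so the strict inequality
    extends from [A0] to [A]. *)
Lemma supp_set_separation (A : set 'rV[int]_n) s0 :
  (forall s, A s -> exists k, s = degS b k) ->
  ~ Gamma_plus R b A (toR R s0) ->
  exists l, [/\ forall i, 0 < dot l (b i),
    forall k, dot l (degS b k) = dot l s0 -> degS b k = s0 &
    forall s, A s -> dot l s0 < dot l s].
Proof.
move=> AS nG.
have [F [FA FP]] := dickson_on (enum 'I_r) [set k | A (degS b k)].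
pose A0 := [seq degS b k | k <- F].
have nG0 : ~ Gamma_plus R b [set` A0] (toR R s0).
  move=> H; apply: nG => B [cB AB]; apply: H; split=> // w [s [v [/= sA0 cv ->]]].
  by apply: AB; exists s, v; split=> //; move: sA0 => /mapP[k /FA Ak ->].
pose V := [seq b i | i : 'I_r] ++ [seq u - s0 | u <- A0].
have bV i : b i \in V by rewrite mem_cat map_f ?mem_enum.
have [l lV ls] := separation s0 bV (posspan_shift b_nonneg bN0 nG0).
have lb i : 0 < dot l (b i) by exact/lV/bV.
exists l; split=> // s As; have [k Es] := AS s As.
have [|f fF fk] := FP k; first by rewrite /= -Es.
have lf : 0 < dot l (degS b f - s0).
  by apply: lV; rewrite mem_cat orbC; apply/orP; left; apply/map_f/map_f.
rewrite dotBr subr_gt0 in lf; apply: lt_le_trans lf _.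
rewrite Es !degSE; apply: ler_sum => i _.
by rewrite ler_pM2l // lez_nat fk ?mem_enum.
Qed.

End Support.

Theorem theorem2p2 (R : realType) (n r : nat) (b : 'I_r -> 'rV[int]_n)
  (b_nonneg : nonneg_generators b)
  (b_lattice : generates_lattice b)
  (cone_dim : full_dimensional (cone R b))
  (cone_sc : strongly_convex (cone R b))
  (I : set ('rV[R[i]]_r -> R[i])) (I_monomial : monomial_ideal b I)
  (G : set ('rV[R[i]]_r -> R[i])) (G_OX : G `<=` OX b)
  (I_gen : I = ideal_gen b G)
  (h : 'rV[R[i]]_r -> R[i]) (h_int : integral_closure b I h) :
  [set toR R s | s in supp b h] `<=` Gamma_plus R b (supp_set b G).
Proof.
move=> _ [s hs <-]; have [bN0|/existsNP[i /negP]] := pselect (forall i, b i != 0).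
  apply: contrapT => nG.
  have [s' [g Gg]|l [lb ls lA]] := supp_set_separation b_nonneg bN0 _ nG.
    exact/suppS/G_OX.
  have hO : OX b h by case: h_int.
  have [k0 Es] := suppS hO hs.
  apply: (supp_OpowN b_nonneg bN0 lb hO hs ls).
  apply: Opow_integral h_int => // u; rewrite I_gen.
  apply: Opow_ideal_gen => // g Gg; apply: Opow_supp => // [|s' gs'].
    exact: G_OX.
  (* For integers, strictness gains the extra 1 in the exponent; nonnegativity of [dot l s] removes
     the absolute value. *)
  have : dot l s < dot l s' by apply: lA; exists g.
  have : 0 <= dot l s by rewrite Es -wdeg_weight.
  lia.
(* No functional is positive on a zero generator; in this case the support of [h] is empty. *)
by rewrite negbK => /eqP bi0; have := supp_zero_gen bi0 hs.
Qed.
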